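(* Let $w_1,w_2,w_3$ be any positive integers. Then for every integer $n\ge 0$ (sums running over nonnegative integers $k,l,m$ with $k+l+m=n$): \begin{align*} &\sum_{k+l+m=n}\binom{n}{k,l,m}S_k(dw_1-1;\chi,\xi^{w_3})\,S_l(dw_2-1;\chi,\xi^{w_1})\,S_m(dw_3-1;\chi,\xi^{w_2})\,w_3^{k-1}w_1^{l-1}w_2^{m-1}\\ =&\sum_{k+l+m=n}\binom{n}{k,l,m}S_k(dw_1-1;\chi,\xi^{w_2})\,S_l(dw_3-1;\chi,\xi^{w_1})\,S_m(dw_2-1;\chi,\xi^{w_3})\,w_2^{k-1}w_1^{l-1}w_3^{m-1}. \end{align*}
   Context: Let $p$ be a fixed prime and $\mathbb{C}_p$ the completion of an algebraic closure of $\mathbb{Q}_p$. Let $\Gamma_r=\{\xi\in\mathbb{C}_p : \xi^{p^s}=1 \text{ for some } s\in\mathbb{Z}_{>0}\}$ (ramified roots of unity) and fix any $\xi\in\Gamma_r$. Let $d$ be a fixed positive integer and $\chi$ a (primitive) Dirichlet character of conductor $d$, viewed as a function $\mathbb{Z}\to\mathbb{C}_p$ via a fixed embedding $\overline{\mathbb{Q}}\to\mathbb{C}_p$ (periodic mod $d$, zero on integers not coprime to $d$; if $d=1$, $\chi\equiv 1$). For integers $k,n\ge 0$ and $\eta\in\Gamma_r$, the $k$th generalized twisted power sum is $S_k(n;\chi,\eta)=\sum_{a=0}^{n}\chi(a)\eta^a a^k$, with the convention $0^0=1$. Also $\binom{n}{k,l,m}=\frac{n!}{k!\,l!\,m!}$.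 *)

(* Defs.v *)
From mathcomp Require Import all_boot all_order all_algebra all_field.
From mathcomp Require Import reals.

Set Implicit Arguments.
Unset Strict Implicit.
Unset Printing Implicit Defensive.

Import Order.TTheory GRing.Theory Num.Theory.
Local Open Scope ring_scope.

Record nonarchimedean_abs (R : realType) (K : fieldType) (v : K -> R) : Prop :=
  NonarchimedeanAbs {
    nabs_ge0 : forall x, 0 <= v x;
    nabs_eq0 : forall x, v x = 0 <-> x = 0;
    nabsM : forall x y, v (x * y) = v x * v y;
    nabsD : forall x y, v (x + y) <= Num.max (v x) (v y) }.

Definition abs_cauchy (R : realType) (K : fieldType) (v : K -> R)
    (u : nat -> K) : Prop :=
  forall e : R, 0 < e ->
  exists N, forall m n, (N <= m)%N -> (N <= n)%N -> v (u m - u n) < e.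

Definition abs_limit (R : realType) (K : fieldType) (v : K -> R)
    (u : nat -> K) (l : K) : Prop :=
  forall e : R, 0 < e -> exists N, forall n, (N <= n)%N -> v (u n - l) < e.

Record is_completion (R : realType) (F K : fieldType)
    (vF : F -> R) (vK : K -> R) (i : {rmorphism F -> K}) : Prop :=
  IsCompletion {
    completion_abs : nonarchimedean_abs vK;
    completion_isometry : forall x, vK (i x) = vF x;
    completion_dense :
      forall (y : K) (e : R), 0 < e -> exists x, vK (y - i x) < e;
    completion_complete :
      forall u, abs_cauchy vK u -> exists l, abs_limit vK u l }.

(* |q|_p = p ^ (- v_p(q)), where v_p(q) = logn p (num) - logn p (den). *)
Definition padic_abs (R : realType) (p : nat) (q : rat) : R :=
  if q == 0 then 0
  else p%:R ^ ((logn p `|denq q|%N)%:Z - (logn p `|numq q|%N)%:Z).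

(* A model of C_p, given with the tower Q -> Q_p -> Qpbar -> C_p of its
   construction: Q_p is the completion of Q for the p-adic absolute value,
   Qpbar is an algebraic closure of Q_p, with an absolute value extending that
   of Q_p, and C_p is the completion of Qpbar.  These data determine C_p up to
   isometric isomorphism. *)
Record padicComplex (R : realType) (p : nat) := PadicComplex {
  Qp : fieldType;
  Qp_abs : Qp -> R;
  rat_to_Qp : {rmorphism rat -> Qp};
  Qp_completion : is_completion (padic_abs R p) Qp_abs rat_to_Qp;
  Qpbar : closedFieldType;
  Qpbar_abs : Qpbar -> R;
  Qp_to_Qpbar : {rmorphism Qp -> Qpbar};
  Qpbar_algebraic : forall x, algebraicOver Qp_to_Qpbar x;
  Qpbar_nonarchimedean : nonarchimedean_abs Qpbar_abs;
  Qpbar_abs_extends : forall x, Qpbar_abs (Qp_to_Qpbar x) = Qp_abs x;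
  Cp :> fieldType;
  Cp_abs : Cp -> R;
  Qpbar_to_Cp : {rmorphism Qpbar -> Cp};
  Cp_completion : is_completion Qpbar_abs Cp_abs Qpbar_to_Cp }.

Definition Gamma_r (p : nat) (K : fieldType) (x : K) : Prop :=
  exists2 s : nat, (0 < s)%N & x ^+ (p ^ s) = 1.

(* algC is an algebraic closure of Q, so it is the natural codomain of Dirichlet
   characters, whose nonzero values are roots of unity. *)
Record dirichlet_character (d : nat) (chi : int -> algC) : Prop :=
  DirichletCharacter {
    dchar1 : chi 1 = 1;
    dcharM : forall a b, chi (a * b) = chi a * chi b;
    dchar_periodic : forall a, chi (a + d%:Z) = chi a;
    dchar_eq0 : forall a, chi a = 0 <-> ~~ coprimez a d%:Z }.

Definition dirichlet_induced (d e : nat) (chi : int -> algC) : Prop :=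
  exists2 psi, dirichlet_character e psi &
    forall a, coprimez a d%:Z -> chi a = psi a.

Record primitive_dirichlet_character (d : nat) (chi : int -> algC) : Prop :=
  PrimitiveDirichletCharacter {
    primitive_dchar : dirichlet_character d chi;
    primitive_conductor :
      forall e, (e %| d)%N -> dirichlet_induced d e chi -> e = d }.

Definition twisted_power_sum (K : fieldType) (chi : int -> K) (eta : K)
    (k n : nat) : K :=
  \sum_(0 <= a < n.+1) chi a%:Z * eta ^+ a * a%:R ^+ k.

(* The division is exact when k + l + m = n. *)
Definition trinomial (n k l m : nat) : nat :=
  (n`! %/ (k`! * l`! * m`!))%N.

(* Main.v *)
(* Put Y = xi e^t.  By the trinomial theorem the left side is, up to the factor
   1/(w1 w2 w3), the n-th t-derivative at 0 of
     \prod_i \sum_(a < d w_i) chi(a) Y^(w_j a),   (i, j) = (1, 3), (2, 1), (3, 2).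
   Since chi has period d, the factor (i, j) equals
     P(Y^(w_j)) (1 - Y^(d w_i w_j)) / (1 - Y^(d w_j)),  P(Y) = \sum_(a < d) chi(a) Y^a,
   so the product is symmetric in w1, w2, w3, and the right side is the same
   expression with w2 and w3 exchanged.  This is an identity of polynomials in
   Y, on which d/dt acts as the Euler operator Y d/dY. *)
From HB Require Import structures.
Require Import Defs.
From mathcomp Require Import all_boot all_order all_algebra all_field.
From mathcomp Require Import reals.
From mathcomp Require Import ring zify.

Import Order.TTheory GRing.Theory Num.Theory.
Local Open Scope ring_scope.


Lemma trinomial_bin (n k l m : nat) :
  (k + l + m = n)%N -> trinomial n k l m = ('C(n, k) * 'C(n - k, l))%N.
Proof.
move=> <-; rewrite /trinomial -addnA addKn.
have fact_lm := @bin_fact (l + m) l (leq_addr m l).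
have fact_klm := @bin_fact (k + (l + m)) k (leq_addr _ k).
rewrite addKn in fact_lm; rewrite addKn -fact_lm in fact_klm.
have -> : ((k + (l + m))`! = 'C(k + (l + m), k) * 'C(l + m, l)
            * (k`! * l`! * m`!))%N by rewrite -fact_klm; nia.
by rewrite mulnK // !muln_gt0 !fact_gt0.
Qed.

Lemma exprD3n (K : comNzRingType) (x y z : K) (n : nat) :
  (x + y + z) ^+ n =
  \sum_(k < n.+1) \sum_(l < n.+1) \sum_(m < n.+1 | (k + l + m == n)%N)
    (trinomial n k l m)%:R * x ^+ k * y ^+ l * z ^+ m.
Proof.
rewrite -addrA addrC exprDn; apply: eq_bigr => k _.
have le_kn : (k <= n)%N by rewrite -ltnS.
rewrite addrC exprDn mulr_suml -sumrMnl.
(* The binomial theorem bounds [l] by [n - k]. The range is widened to [n.+1]: below the old bound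
   [m] must be [n - k - l], beyond it no [m] is admissible. *)
rewrite (big_ord_widen n.+1 (fun l => (z ^+ (n - k - l) * y ^+ l
  *+ 'C(n - k, l) * x ^+ k) *+ 'C(n, k))) ?ltnS ?leq_subr //.
rewrite big_mkcond; apply: eq_bigr => l _.
case: ifP => [le_l | gt_l].
  have lt_m : (n - k - l < n.+1)%N by lia.
  rewrite (big_pred1 (Ordinal lt_m)) => [|m] /=.
    rewrite trinomial_bin; last lia.
    by rewrite natrM -[LHS]mulr_natr -[X in X * x ^+ k * _]mulr_natr; ring.
  by rewrite -val_eqE /=; lia.
by rewrite big_pred0 // => m; lia.
Qed.

Section EulerOperator.

Variable K : comNzRingType.

Definition euler (q : {poly K}) : {poly K} := 'X * q^`().

Fact euler_is_linear : linear euler.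
Proof. by move=> a q r; rewrite /euler linearP mulrDr scalerAr. Qed.

HB.instance Definition _ :=
  GRing.isLinear.Build K {poly K} {poly K} *:%R euler euler_is_linear.

Lemma iter_eulerD (n : nat) : {morph iter n euler : q r / q + r}.
Proof. by elim: n => // n IHn q r; rewrite !iterS IHn linearD. Qed.

Lemma iter_euler0 (n : nat) : iter n euler 0 = 0.
Proof. by elim: n => //= n ->; rewrite linear0. Qed.

Lemma iter_eulerZ (n : nat) (a : K) (q : {poly K}) :
  iter n euler (a *: q) = a *: iter n euler q.
Proof. by elim: n => //= n ->; rewrite linearZ. Qed.

Lemma iter_eulerXn (n j : nat) : iter n euler 'X^j = (j%:R ^+ n) *: 'X^j.
Proof.
elim: n => [|n IHn] /=; first by rewrite expr0 scale1r.
rewrite IHn linearZ /= /euler derivXn exprSr -scalerA; congr (_ *: _).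
(* Multiplying by ['X] restores the lowered exponent only for positive [j]; for [j = 0] both sides
   vanish. *)
case: j {IHn} => [|j] /=; first by rewrite mulr0n mulr0 scale0r.
by rewrite mulrnAr -exprS scaler_nat.
Qed.

Lemma horner_iter_euler_sum (n : nat) (I : Type) (r : seq I)
    (F : I -> {poly K}) (x : K) :
  (iter n euler (\sum_(i <- r) F i)).[x] = \sum_(i <- r) (iter n euler (F i)).[x].
Proof.
by rewrite (big_morph _ (iter_eulerD n) (iter_euler0 n)) horner_sum.
Qed.

Definition twisted_poly (f : nat -> K) (N u : nat) : {poly K} :=
  \sum_(a < N) f a *: 'X^(u * a).

(** The product expands into monomials of degree [u * a + v * b + w * c], which are eigenvectors of
    [euler] with their degree as eigenvalue. *)
Lemma horner_iter_euler_twisted3 (f g h : nat -> K) (n A B C u v w : nat)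
    (x : K) :
  (iter n euler
     (twisted_poly f A u * twisted_poly g B v * twisted_poly h C w)).[x] =
  \sum_(a < A) \sum_(b < B) \sum_(c < C)
    (f a * x ^+ (u * a)) * (g b * x ^+ (v * b)) * (h c * x ^+ (w * c))
    * (u%:R * a%:R + v%:R * b%:R + w%:R * c%:R) ^+ n.
Proof.
rewrite /twisted_poly -mulrA mulr_suml horner_iter_euler_sum.
apply: eq_bigr => a _; rewrite mulr_suml mulr_sumr horner_iter_euler_sum.
apply: eq_bigr => b _; rewrite !mulr_sumr horner_iter_euler_sum.
apply: eq_bigr => c _.
rewrite -!scalerAl -!scalerAr -!exprD !iter_eulerZ iter_eulerXn !hornerZ.
by rewrite hornerXn !natrD !natrM !exprD addrA; ring.
Qed.

(** A geometric sum with denominators cleared: by periodicity the block of index [N] is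
    ['X^(d * u * N)] times the first one, and the induction telescopes. *)
Lemma twisted_poly_periodic (f : nat -> K) (d N u : nat) :
    (forall a, f (a + d)%N = f a) ->
  twisted_poly f (d * N) u * (1 - 'X^(d * u)) =
  twisted_poly f d u * (1 - 'X^(d * u * N)).
Proof.
move=> f_per; have f_perM j a : f (d * j + a)%N = f a.
  by elim: j => [|j IHj]; rewrite ?muln0 // mulnSr addnAC f_per.
elim: N => [|N IHN].
  by rewrite !muln0 /twisted_poly big_ord0 mul0r expr0 subrr mulr0.
have -> : twisted_poly f (d * N.+1) u =
    twisted_poly f (d * N) u + 'X^(d * u * N) * twisted_poly f d u.
  rewrite /twisted_poly mulnSr big_split_ord /=; congr (_ + _).
  rewrite mulr_sumr; apply: eq_bigr => a _.
  by rewrite f_perM -scalerAr -exprD; congr (_ *: 'X^_); lia.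
by rewrite mulrDl IHN mulnS exprD; ring.
Qed.

End EulerOperator.

Arguments euler {K} q.
Arguments twisted_poly {K} f N u.

(** Both sides carry the twists [w1], [w2], [w3] once each, hence have the same denominators. These
    are nonzero and cancel in an integral domain. *)
Lemma twisted_poly3_sym (K : idomainType) (f : nat -> K) (d w1 w2 w3 : nat) :
    (forall a, f (a + d)%N = f a) ->
    (0 < d)%N -> (0 < w1)%N -> (0 < w2)%N -> (0 < w3)%N ->
  twisted_poly f (d * w1) w3 * twisted_poly f (d * w2) w1
    * twisted_poly f (d * w3) w2 =
  twisted_poly f (d * w1) w2 * twisted_poly f (d * w3) w1
    * twisted_poly f (d * w2) w3.
Proof.
move=> f_per d_gt0 w1_gt0 w2_gt0 w3_gt0.
have den_neq0 w : (0 < w)%N -> 1 - 'X^(d * w) != 0 :> {poly K}.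
  move=> w_gt0; rewrite -oppr_eq0 opprB monic_neq0 //.
  by rewrite monicXnsubC // muln_gt0 d_gt0.
have den3_neq0 :
    (1 - 'X^(d * w3)) * (1 - 'X^(d * w1)) * (1 - 'X^(d * w2)) != 0 :> {poly K}.
  by rewrite !mulf_neq0 ?den_neq0.
apply: (mulIf den3_neq0).
have per N u := twisted_poly_periodic K f d N u f_per.
transitivity ((twisted_poly f (d * w1) w3 * (1 - 'X^(d * w3)))
  * (twisted_poly f (d * w2) w1 * (1 - 'X^(d * w1)))
  * (twisted_poly f (d * w3) w2 * (1 - 'X^(d * w2)))); first by ring.
transitivity ((twisted_poly f (d * w1) w2 * (1 - 'X^(d * w2)))
  * (twisted_poly f (d * w3) w1 * (1 - 'X^(d * w1)))
  * (twisted_poly f (d * w2) w3 * (1 - 'X^(d * w3)))); last by ring.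
(* The exponents are put in one order, so that [ring] sees the same powers of ['X] on both sides. *)
rewrite !per [(d * w2 * w1)%N]mulnAC [(d * w3 * w1)%N]mulnAC.
by rewrite [(d * w3 * w2)%N]mulnAC; ring.
Qed.

(** Absorbing [u ^ k] into the power sum turns [a ^ k] into [(u * a) ^ k], and likewise for [v] and
    [w]; the trinomial theorem then collects the [n]-th power produced by [euler]. *)
Lemma sum_trinomial_twisted_power_sum (K : fieldType) (chi : int -> K) (x : K)
    (n A B C u v w : nat) :
    (0 < A)%N -> (0 < B)%N -> (0 < C)%N ->
    u%:R != 0 :> K -> v%:R != 0 :> K -> w%:R != 0 :> K ->
  \sum_(k < n.+1) \sum_(l < n.+1) \sum_(m < n.+1 | (k + l + m == n)%N)
    (trinomial n k l m)%:R
    * twisted_power_sum chi (x ^+ u) k (A - 1)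
    * twisted_power_sum chi (x ^+ v) l (B - 1)
    * twisted_power_sum chi (x ^+ w) m (C - 1)
    * u%:R ^ (k%:Z - 1) * v%:R ^ (l%:Z - 1) * w%:R ^ (m%:Z - 1) =
  (iter n (@euler K) (twisted_poly (fun a => chi a%:Z) A u
     * twisted_poly (fun a => chi a%:Z) B v
     * twisted_poly (fun a => chi a%:Z) C w)).[x] / (u%:R * v%:R * w%:R).
Proof.
move=> A_gt0 B_gt0 C_gt0 u_neq0 v_neq0 w_neq0.
(* The exponent [k - 1] is [-1] at [k = 0], so splitting off [z ^ -1] needs [z] nonzero. Positivity
   of [N] makes the range up to [N - 1] have [N] terms. *)
have sumE (N z k : nat) : (0 < N)%N -> z%:R != 0 :> K ->
    twisted_power_sum chi (x ^+ z) k (N - 1) * z%:R ^ (k%:Z - 1) =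
    (\sum_(a < N) chi a%:Z * x ^+ (z * a) * (z%:R * a%:R) ^+ k) / z%:R.
  move=> N_gt0 z_neq0; rewrite expfzDr // mulrA exprN1; congr (_ / _).
  rewrite /twisted_power_sum subn1 prednK // big_mkord mulr_suml.
  by apply: eq_bigr => a _; rewrite exprM exprMn -exprnP; ring.
rewrite horner_iter_euler_twisted3.
under [in RHS]eq_bigr => a _ do under eq_bigr => b _ do
  under eq_bigr => c _ do rewrite exprD3n.
pose T (a b c k l m : nat) := (trinomial n k l m)%:R
  * (chi a%:Z * x ^+ (u * a) * (u%:R * a%:R) ^+ k)
  * (chi b%:Z * x ^+ (v * b) * (v%:R * b%:R) ^+ l)
  * (chi c%:Z * x ^+ (w * c) * (w%:R * c%:R) ^+ m).
transitivity ((\sum_(a < A) \sum_(b < B) \sum_(c < C) \sum_(k < n.+1)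
   \sum_(l < n.+1) \sum_(m < n.+1 | (k + l + m == n)%N) T a b c k l m)
   / (u%:R * v%:R * w%:R)); last first.
  congr (_ / _); apply: eq_bigr => a _; apply: eq_bigr => b _.
  apply: eq_bigr => c _; rewrite mulr_sumr; apply: eq_bigr => k _.
  rewrite mulr_sumr; apply: eq_bigr => l _.
  by rewrite mulr_sumr; apply: eq_bigr => m _; rewrite /T; ring.
transitivity ((\sum_(k < n.+1) \sum_(l < n.+1)
   \sum_(m < n.+1 | (k + l + m == n)%N) \sum_(a < A) \sum_(b < B) \sum_(c < C)
   T a b c k l m) / (u%:R * v%:R * w%:R)); last first.
  congr (_ / _).
  (* The sums over [k], [l] and [m] are moved outward in turn, each past [c], then [b], then [a]. *)
  under [RHS]eq_bigr => a _ do under eq_bigr => b _ do rewrite exchange_big /=.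
  under [RHS]eq_bigr => a _ do rewrite exchange_big /=.
  rewrite [RHS]exchange_big /=; apply: eq_bigr => k _.
  under [RHS]eq_bigr => a _ do under eq_bigr => b _ do rewrite exchange_big /=.
  under [RHS]eq_bigr => a _ do rewrite exchange_big /=.
  rewrite [RHS]exchange_big /=; apply: eq_bigr => l _.
  under [RHS]eq_bigr => a _ do under eq_bigr => b _ do rewrite exchange_big /=.
  under [RHS]eq_bigr => a _ do rewrite exchange_big /=.
  by rewrite [RHS]exchange_big.
rewrite mulr_suml; apply: eq_bigr => k _.
rewrite mulr_suml; apply: eq_bigr => l _.
rewrite mulr_suml; apply: eq_bigr => m _.
have regroup (t p q r p' q' r' : K) :
  t * p * q * r * p' * q' * r' = t * (p * p') * (q * q') * (r * r') by ring.
rewrite regroup !sumE // !invfM.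
rewrite /T.
under [in RHS]eq_bigr => a _ do under eq_bigr => b _ do rewrite -mulr_sumr.
under [in RHS]eq_bigr => a _ do rewrite -mulr_suml -mulr_sumr.
by rewrite -!mulr_suml -mulr_sumr; ring.
Qed.

Theorem theorem4p8 (R : realType) (p : nat) (p_prime : prime p)
    (C : padicComplex R p) (iota : {rmorphism algC -> C})
    (xi : C) (xi_Gamma : Gamma_r p xi)
    (d : nat) (d_gt0 : (0 < d)%N)
    (chi : int -> algC) (chi_prim : primitive_dirichlet_character d chi)
    (w1 w2 w3 : nat) (w1_gt0 : (0 < w1)%N) (w2_gt0 : (0 < w2)%N)
    (w3_gt0 : (0 < w3)%N) (n : nat) :
  let S (k N : nat) (eta : C) :=
    twisted_power_sum (fun a => iota (chi a)) eta k N in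
  \sum_(k < n.+1) \sum_(l < n.+1) \sum_(m < n.+1 | (k + l + m == n)%N)
    (trinomial n k l m)%:R
    * S k (d * w1 - 1)%N (xi ^+ w3)
    * S l (d * w2 - 1)%N (xi ^+ w1)
    * S m (d * w3 - 1)%N (xi ^+ w2)
    * w3%:R ^ (k%:Z - 1) * w1%:R ^ (l%:Z - 1) * w2%:R ^ (m%:Z - 1)
  =
  \sum_(k < n.+1) \sum_(l < n.+1) \sum_(m < n.+1 | (k + l + m == n)%N)
    (trinomial n k l m)%:R
    * S k (d * w1 - 1)%N (xi ^+ w2)
    * S l (d * w3 - 1)%N (xi ^+ w1)
    * S m (d * w2 - 1)%N (xi ^+ w3)
    * w2%:R ^ (k%:Z - 1) * w1%:R ^ (l%:Z - 1) * w3%:R ^ (m%:Z - 1).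
Proof.
move=> S.
have [chi_dir _] := chi_prim.
have chi_per (a : nat) : iota (chi (a + d)%N%:Z) = iota (chi a%:Z).
  by rewrite PoszD dchar_periodic.
(* Characteristic zero passes from [algC] to [C] through the injective [iota]. *)
have natC_neq0 w : (0 < w)%N -> w%:R != 0 :> C.
  by move=> w_gt0; rewrite -(rmorph_nat iota) fmorph_eq0 pnatr_eq0 -lt0n.
rewrite /S !sum_trinomial_twisted_power_sum ?natC_neq0 ?muln_gt0 ?d_gt0 //.
rewrite (@twisted_poly3_sym _ _ _ _ _ _ chi_per) //.
(* Only the order of the weights in the denominator still differs. *)
by congr (_ / _); ring.
Qed.
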